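(* Let $\mathbf{A}$ and $\mathbf{B}$ be categories with finite limits and let $V\colon\mathbf{A}\to\mathbf{B}$ be a functor that preserves finite limits. If $V$ is faithful and $\mathbf{A}$ admits a $V$-Mal'tsev operation, then $\mathbf{A}$ is a weakly Mal'tsev category.
   Context: A $V$-Mal'tsev operation on $\mathbf{A}$ is a natural transformation $p\colon V^3\to V$ with components $p_A\colon V(A)\times V(A)\times V(A)\to V(A)$ in $\mathbf{B}$ such that $p_A\langle x,y,y\rangle=x=p_A\langle y,y,x\rangle$ for all objects $B$ of $\mathbf{B}$ and all $x,y\colon B\to V(A)$. A category with finite limits is weakly Mal'tsev if for every diagram $f\colon A\to B$, $r\colon B\to A$, $g\colon C\to B$, $s\colon B\to C$ with $fr=1_B=gs$, the induced morphisms $e_1=\langle 1_A,sf\rangle\colon A\to A\times_BC$ and $e_2=\langle rg,1_C\rangle\colon C\to A\times_BC$ into the pullback of $f$ and $g$ are jointly epimorphic. *)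

(* Defs.v *)
From Stdlib Require Import List FinFun.
Import ListNotations.

Set Implicit Arguments.
Unset Strict Implicit.
Unset Printing Implicit Defensive.

Declare Scope cat_scope.
Local Open Scope cat_scope.

Record Category : Type := {
  Obj :> Type;
  Hom : Obj -> Obj -> Type;
  id : forall X, Hom X X;
  comp : forall X Y Z, Hom Y Z -> Hom X Y -> Hom X Z;
  comp_id_l : forall X Y (f : Hom X Y), comp (id Y) f = f;
  comp_id_r : forall X Y (f : Hom X Y), comp f (id X) = f;
  comp_assoc : forall W X Y Z (h : Hom Y Z) (g : Hom X Y) (f : Hom W X),
    comp h (comp g f) = comp (comp h g) f
}.

Arguments Hom {_} _ _.
Arguments id {_} _.
Arguments comp {_ _ _ _} _ _.

Notation "g \o f" := (comp g f) (at level 40, left associativity) : cat_scope.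

Record Functor (C D : Category) : Type := {
  fobj :> C -> D;
  fmap : forall X Y : C, Hom X Y -> Hom (fobj X) (fobj Y);
  fmap_id : forall X : C, fmap (id X) = id (fobj X);
  fmap_comp : forall (X Y Z : C) (g : Hom Y Z) (f : Hom X Y),
    fmap (g \o f) = fmap g \o fmap f
}.

Arguments fmap {_ _} _ {_ _} _.

Definition faithful (C D : Category) (F : Functor C D) : Prop :=
  forall (X Y : C) (f g : Hom X Y), fmap F f = fmap F g -> f = g.

Definition functor_comp (C D E : Category) (G : Functor D E) (F : Functor C D) :
  Functor C E.
Proof.
refine {| fobj := fun X => G (F X);
          fmap := fun X Y (f : Hom X Y) => fmap G (fmap F f) |}.
- intros X. now rewrite !fmap_id.
- intros X Y Z g f. now rewrite !fmap_comp.
Defined.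

Definition const_functor (J C : Category) (X : C) : Functor J C.
Proof.
refine {| fobj := fun _ => X; fmap := fun _ _ _ => id X |}.
- reflexivity.
- intros. symmetry. apply comp_id_l.
Defined.

Record NatTrans (C D : Category) (F G : Functor C D) : Type := {
  component :> forall X : C, Hom (F X) (G X);
  naturality : forall (X Y : C) (f : Hom X Y),
    component Y \o fmap F f = fmap G f \o component X
}.

Record Cone (J C : Category) (D : Functor J C) : Type := {
  apex : C;
  leg : forall j : J, Hom apex (D j);
  leg_natural : forall (i j : J) (u : Hom i j), fmap D u \o leg i = leg j
}.

Arguments apex {_ _ _} _.
Arguments leg {_ _ _} _ _.

Definition cone_morphism (J C : Category) (D : Functor J C) (c c' : Cone D)
    (h : Hom (apex c) (apex c')) : Prop :=
  forall j : J, leg c' j \o h = leg c j.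

Definition is_limit (J C : Category) (D : Functor J C) (c : Cone D) : Prop :=
  forall c' : Cone D, exists! h : Hom (apex c') (apex c), cone_morphism h.

(* A chosen limit: unlike in [is_limit], the mediating morphisms are data. *)
Record Limit (J C : Category) (D : Functor J C) : Type := {
  limit_cone :> Cone D;
  lift : forall c : Cone D, Hom (apex c) (apex limit_cone);
  liftP : forall c : Cone D,
    unique (fun h : Hom (apex c) (apex limit_cone) => cone_morphism h) (lift c)
}.

Definition finite_category (J : Category) : Prop :=
  Finite J /\ forall i j : J, Finite (Hom i j).

(* Finite limits are chosen, so that functorial constructions such as [V^3]
   are defined; no property below depends on the choice up to isomorphism. *)
Definition FiniteLimits (C : Category) : Type :=
  forall J : Category, finite_category J -> forall D : Functor J C, Limit D.

Definition map_cone (J C E : Category) (F : Functor C E) (D : Functor J C)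
    (c : Cone D) : Cone (functor_comp F D).
Proof.
refine {| apex := F (apex c);
          leg := fun j => fmap F (leg c j) : Hom _ (functor_comp F D j) |}.
intros i j u. simpl. now rewrite <- fmap_comp, leg_natural.
Defined.

Definition preserves_finite_limits (C E : Category) (F : Functor C E) : Prop :=
  forall J : Category, finite_category J ->
  forall (D : Functor J C) (c : Cone D), is_limit c -> is_limit (map_cone F c).

Inductive three : Set := t0 | t1 | t2.

Definition discrete3 : Category.
Proof.
refine {| Obj := three; Hom := fun i j => i = j; id := fun i => eq_refl;
          comp := fun i j k (v : j = k) (u : i = j) => eq_trans u v |}.
- now intros i j [].
- now intros i j [].
- now intros i j k l [] [] [].
Defined.

Lemma discrete3_finite : finite_category discrete3.
Proof.
split.
- exists [t0; t1; t2]. intros []; simpl; tauto.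
- intros i j. simpl. destruct i, j; try (exists []; intros e; discriminate e);
    exists [eq_refl]; intros e; left; apply Eqdep_dec.UIP_dec; decide equality.
Defined.

Section Cube.

Variables (C : Category) (lim : FiniteLimits C).

Definition cube_limit (X : C) : Limit (const_functor discrete3 X) :=
  lim discrete3_finite (const_functor discrete3 X).

Definition cube (X : C) : C := apex (cube_limit X).

Definition cube_proj (X : C) (i : three) : Hom (cube X) X :=
  leg (cube_limit X) i.

Definition triple_cone (B X : C) (x y z : Hom B X) :
  Cone (const_functor discrete3 X).
Proof.
refine {| apex := B;
          leg := fun i : discrete3 =>
            match i with t0 => x | t1 => y | t2 => z end
            : Hom B (const_functor discrete3 X i) |}.
intros i j []. apply comp_id_l.
Defined.

Definition triple (B X : C) (x y z : Hom B X) : Hom B (cube X) :=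
  lift (cube_limit X) (triple_cone x y z).

Lemma cube_proj_triple (B X : C) (x y z : Hom B X) (i : three) :
  cube_proj X i \o triple x y z =
  match i with t0 => x | t1 => y | t2 => z end.
Proof. exact (proj1 (liftP (cube_limit X) (triple_cone x y z)) i). Qed.

Lemma triple_unique (B X : C) (x y z : Hom B X) (h : Hom B (cube X)) :
  cube_proj X t0 \o h = x -> cube_proj X t1 \o h = y ->
  cube_proj X t2 \o h = z -> triple x y z = h.
Proof.
intros H0 H1 H2.
apply (proj2 (liftP (cube_limit X) (triple_cone x y z))).
intros []; assumption.
Qed.

End Cube.

Arguments cube {_} _ _.
Arguments cube_proj {_} _ _ _.
Arguments triple {_} _ {_ _} _ _ _.

(* The functor [V^3], sending [X] to [V X * V X * V X]. *)
Definition power3 (A B : Category) (limB : FiniteLimits B) (V : Functor A B) :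
  Functor A B.
Proof.
refine {| fobj := fun X => cube limB (V X);
          fmap := fun X Y (f : Hom X Y) =>
            triple limB (fmap V f \o cube_proj limB (V X) t0)
                        (fmap V f \o cube_proj limB (V X) t1)
                        (fmap V f \o cube_proj limB (V X) t2) |}.
- intros X. rewrite fmap_id, !comp_id_l. apply triple_unique; apply comp_id_r.
- intros X Y Z g f. rewrite fmap_comp.
  apply triple_unique; now rewrite comp_assoc, cube_proj_triple,
    <- comp_assoc, cube_proj_triple, comp_assoc.
Defined.

Definition maltsev_operation (A B : Category) (limB : FiniteLimits B)
    (V : Functor A B) (p : NatTrans (power3 limB V) V) : Prop :=
  forall (X : A) (B0 : B) (x y : Hom B0 (V X)),
    p X \o triple limB x y y = x /\ x = p X \o triple limB y y x.

Definition admits_maltsev_operation (A B : Category) (limB : FiniteLimits B)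
    (V : Functor A B) : Prop :=
  exists p : NatTrans (power3 limB V) V, maltsev_operation p.

Definition is_pullback (C : Category) (X Y Z : C) (f : Hom X Y) (g : Hom Z Y)
    (P : C) (p1 : Hom P X) (p2 : Hom P Z) : Prop :=
  f \o p1 = g \o p2 /\
  forall (W : C) (h : Hom W X) (k : Hom W Z), f \o h = g \o k ->
    exists! w : Hom W P, p1 \o w = h /\ p2 \o w = k.

Definition jointly_epi (C : Category) (X Z P : C) (e1 : Hom X P)
    (e2 : Hom Z P) : Prop :=
  forall (W : C) (u v : Hom P W),
    u \o e1 = v \o e1 -> u \o e2 = v \o e2 -> u = v.

(* The equations on [e1] and [e2] say [e1 = <1, s f>] and [e2 = <r g, 1>]. *)
Definition weakly_maltsev (C : Category) : Prop :=
  forall (X Y Z : C) (f : Hom X Y) (r : Hom Y X) (g : Hom Z Y) (s : Hom Y Z),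
    f \o r = id Y -> g \o s = id Y ->
  forall (P : C) (p1 : Hom P X) (p2 : Hom P Z), is_pullback f g p1 p2 ->
  forall (e1 : Hom X P) (e2 : Hom Z P),
    p1 \o e1 = id X -> p2 \o e1 = s \o f ->
    p1 \o e2 = r \o g -> p2 \o e2 = id Z ->
    jointly_epi e1 e2.

(* Main.v *)
From Stdlib Require Import List.
Require Import Defs.
Import ListNotations.

(** A generalized element of the pullback [P] of [f] and [g] is a pair [(a, c)]
    with [f a = g c].  It is the Mal'tsev combination of the three elements
    [(a, s f a)], [(r f a, s f a)] and [(r g c, c)]: in the first coordinate
    the last two entries agree (as [r g c = r f a]), in the second the first
    two do.  These elements are [e1 a], [e1 (r f a)] and [e2 c], so each lies
    in the image of [e1] or of [e2].

    This computation takes place in the category [B], on the object [V P]; it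
    determines the result because the maps [V p1] and [V p2] remain jointly
    monic, [V] preserving pullbacks ([preserved_pullback_jointly_monic]).  So
    the identity of [V P] equals [p (V (e1 p1), V (e1 r f p1), V (e2 p2))]
    ([maltsev_decomposition]).  By naturality of [p], composing with [V u]
    expresses [V u] through [u e1] and [u e2] only, so two arrows that agree on
    [e1] and [e2] have the same image under [V], and are equal by
    faithfulness. *)

Set Implicit Arguments.
Unset Strict Implicit.
Unset Printing Implicit Defensive.

Local Open Scope cat_scope.

(** The poset [t0 <= t2 >= t1], whose diagrams are cospans.  Empty and
    singleton types as hom-sets let every law be checked by cases, without
    any equality between proofs of the order relation. *)
Definition cospan_hom (i j : three) : Type :=
  match i, j with
  | t0, t0 | t1, t1 | t2, t2 | t0, t2 | t1, t2 => unit
  | _, _ => Empty_set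
  end.

Definition cospan_shape : Category.
Proof.
refine {| Obj := three; Hom := cospan_hom;
          id := fun i => match i return cospan_hom i i with
                         | t0 => tt | t1 => tt | t2 => tt end;
          comp := fun i j k =>
            match i, j, k return cospan_hom j k -> cospan_hom i j ->
                                 cospan_hom i k with
            | t0, t0, t0 | t1, t1, t1 | t2, t2, t2
            | t0, t0, t2 | t0, t2, t2 | t1, t1, t2 | t1, t2, t2 =>
                fun _ _ => tt
            | _, _, _ => fun v u =>
                ltac:(solve [destruct u | destruct v])
            end |}.
- now intros [] [] [].
- now intros [] [] [].
- now intros [] [] [] [] [] [] [].
Defined.

Lemma cospan_shape_finite : finite_category cospan_shape.
Proof.
split.
- exists [t0; t1; t2]. intros []; simpl; tauto.
- intros [] []; (exists [tt]; intros []; simpl; tauto) ||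
    (exists []; intros []).
Qed.

Definition cospan (C : Category) (X Y Z : C) (f : Hom X Y) (g : Hom Z Y) :
  Functor cospan_shape C.
Proof.
pose (F := fun i : three => match i with t0 => X | t1 => Z | t2 => Y end).
refine {| fobj := F : cospan_shape -> C;
          fmap := fun i j : three =>
            match i, j return cospan_hom i j -> Hom (F i) (F j) with
            | t0, t0 => fun _ => id X
            | t1, t1 => fun _ => id Z
            | t2, t2 => fun _ => id Y
            | t0, t2 => fun _ => f
            | t1, t2 => fun _ => g
            | _, _ => fun u => match u with end
            end |}.
- now intros [].
- intros [] [] [] [] []; simpl; symmetry;
    first [apply comp_id_l | apply comp_id_r].
Defined.

Definition square_cone (C : Category) (X Y Z P : C) (f : Hom X Y)
    (g : Hom Z Y) (p1 : Hom P X) (p2 : Hom P Z) (E : f \o p1 = g \o p2) :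
  Cone (cospan f g).
Proof.
refine {| apex := P;
          leg := fun j : cospan_shape =>
            match j return Hom P (cospan f g j) with
            | t0 => p1 | t1 => p2 | t2 => f \o p1 end |}.
intros [] [] []; simpl; first [apply comp_id_l | reflexivity | now symmetry].
Defined.

Lemma pullback_is_limit (C : Category) (X Y Z P : C) (f : Hom X Y)
    (g : Hom Z Y) (p1 : Hom P X) (p2 : Hom P Z) (E : f \o p1 = g \o p2) :
  is_pullback f g p1 p2 -> is_limit (square_cone E).
Proof.
intros [_ U] c.
pose proof (leg_natural c (i := t0) (j := t2) tt) as L0.
pose proof (leg_natural c (i := t1) (j := t2) tt) as L1.
simpl in L0, L1.
destruct (U _ (leg c t0) (leg c t1)) as [w [[W1 W2] Wu]].
{ exact (eq_trans L0 (eq_sym L1)). }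
exists w. split.
- intros []; simpl; [assumption | assumption |].
  exact (eq_trans (eq_sym (comp_assoc f p1 w))
           (eq_trans (f_equal (comp f) W1) L0)).
- intros h Hh. apply Wu. split; [exact (Hh t0) | exact (Hh t1)].
Qed.

Lemma limit_legs_jointly_monic (J C : Category) (D : Functor J C)
    (c : Cone D) (W : C) (h k : Hom W (apex c)) :
  is_limit c -> (forall j, leg c j \o h = leg c j \o k) -> h = k.
Proof.
intros L E.
assert (N : forall i j (u : Hom i j),
          fmap D u \o (leg c i \o h) = leg c j \o h).
{ intros i j u. now rewrite comp_assoc, leg_natural. }
destruct (L {| leg := fun j => leg c j \o h; leg_natural := N |})
  as [m [_ U]].
rewrite <- (U h), <- (U k); try reflexivity.
- intros j. symmetry. apply E.
- intros j. reflexivity.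
Qed.

Lemma preserved_pullback_jointly_monic (A B : Category) (V : Functor A B)
    (X Y Z P : A) (f : Hom X Y) (g : Hom Z Y) (p1 : Hom P X) (p2 : Hom P Z)
    (W : B) (h k : Hom W (V P)) :
  preserves_finite_limits V -> is_pullback f g p1 p2 ->
  fmap V p1 \o h = fmap V p1 \o k -> fmap V p2 \o h = fmap V p2 \o k -> h = k.
Proof.
intros HV HP E1 E2.
pose proof (HV _ cospan_shape_finite _ _
              (pullback_is_limit (proj1 HP) HP)) as L.
apply (limit_legs_jointly_monic L).
intros []; simpl; [assumption | assumption |].
now rewrite fmap_comp, <- !comp_assoc, E1.
Qed.

(** Naturality of [p] on generalized elements: [V t] is a homomorphism for
    the ternary operations [p]. *)
Lemma ternary_operation_natural (A B : Category) (limB : FiniteLimits B)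
    (V : Functor A B) (p : NatTrans (power3 limB V) V) (X Y : A)
    (t : Hom X Y) (W : B) (x y z : Hom W (V X)) :
  fmap V t \o (p X \o triple limB x y z) =
  p Y \o triple limB (fmap V t \o x) (fmap V t \o y) (fmap V t \o z).
Proof.
rewrite comp_assoc, <- naturality, <- comp_assoc. f_equal.
symmetry. simpl.
apply triple_unique; now rewrite comp_assoc, cube_proj_triple,
  <- comp_assoc, cube_proj_triple.
Qed.

(** The Mal'tsev identities, one in each coordinate of the pullback, recover
    the generic element of [V P] from elements in the images of [V e1] and
    [V e2]. *)
Lemma maltsev_decomposition (A B : Category) (limB : FiniteLimits B)
    (V : Functor A B) (p : NatTrans (power3 limB V) V)
    (X Y Z P : A) (f : Hom X Y) (r : Hom Y X) (g : Hom Z Y) (s : Hom Y Z)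
    (p1 : Hom P X) (p2 : Hom P Z) (e1 : Hom X P) (e2 : Hom Z P) :
  preserves_finite_limits V -> maltsev_operation p ->
  f \o r = id Y -> is_pullback f g p1 p2 ->
  p1 \o e1 = id X -> p2 \o e1 = s \o f ->
  p1 \o e2 = r \o g -> p2 \o e2 = id Z ->
  p P \o triple limB (fmap V (e1 \o p1)) (fmap V (e1 \o (r \o (f \o p1))))
                     (fmap V (e2 \o p2)) = id (V P).
Proof.
intros HV Hp fr HP p1e1 p2e1 p1e2 p2e2.
apply (preserved_pullback_jointly_monic HV HP);
  rewrite ternary_operation_natural, comp_id_r, <- !fmap_comp, !comp_assoc.
- rewrite p1e1, p1e2, !comp_id_l.
  (* [r g p2 = r f p1]: the last two first coordinates agree. *)
  rewrite <- (comp_assoc r g p2), <- (proj1 HP), comp_assoc.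
  apply (proj1 (Hp _ _ _ _)).
- rewrite p2e1, p2e2, comp_id_l.
  (* [s f r f p1 = s f p1]: the first two second coordinates agree. *)
  rewrite <- (comp_assoc s f r), fr, comp_id_r.
  symmetry. apply (proj2 (Hp _ _ _ _)).
Qed.

Theorem proposition5p3 (A B : Category) (limA : FiniteLimits A)
    (limB : FiniteLimits B) (V : Functor A B) :
  preserves_finite_limits V -> faithful V ->
  admits_maltsev_operation limB V ->
  weakly_maltsev A.
Proof.
intros HV faithfulV [p Hp] X Y Z f r g s fr gs P p1 p2 HP e1 e2
  p1e1 p2e1 p1e2 p2e2 W u v E1 E2.
apply faithfulV.
rewrite <- (comp_id_r (fmap V u)), <- (comp_id_r (fmap V v)).
rewrite <- (maltsev_decomposition HV Hp fr HP p1e1 p2e1 p1e2 p2e2).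
rewrite !ternary_operation_natural, <- !fmap_comp.
now rewrite !(comp_assoc u), !(comp_assoc v), E1, E2.
Qed.
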